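(* For $k\in\mathbb{N}^+$, $\theta\in[0,1]$ and $\nu\in(0,+\infty)$ let $$M(2k+1,\theta,\nu)=(I-\theta\nu L)^{-1}\bigl(I+(1-\theta)\nu L\bigr)\in\mathbb{R}^{(2k+1)\times(2k+1)}$$ be the full discretization matrix corresponding to the second-order centered discretization in space and the $\theta$-method in time. Then: (a) Fix $0\le\theta<1/2$ arbitrarily. Then $M(2k+1,\theta,\nu)\ge 0$ can never hold, i.e. for any $k\in\mathbb{N}^+$ and $\nu>0$ there is at least one strictly negative entry of the matrix $M(2k+1,\theta,\nu)$. (b) Let $\theta=1/2$. Then $M\left(2k+1,\frac12,\nu\right)\ge 0$ if and only if $k=1$ and $\nu=4$. (c) Fix $1/2<\theta<1$ arbitrarily. Then there are only finitely many values of $k\in\mathbb{N}^+$ for which there exists $\nu>0$ with $M(2k+1,\theta,\nu)\ge 0$. For any such value of $k$, the set of $\nu\in(0,+\infty)$ with $M(2k+1,\theta,\nu)\ge 0$ has the form $\nu_R(k,\theta)\le\nu\le\nu_L(k,\theta)$ with suitable constants $0<\nu_R(k,\theta)\le\nu_L(k,\theta)\le+\infty$ (the possible case $\nu_L(k,\theta)=+\infty$ means that there is no upper but only a lower bound on $\nu$). (d) Let $\theta=1$. Then for each $k\in\mathbb{N}^+$ there is a constant $\nu_R(k,1)>0$ such that $$M(2k+1,1,\nu)\ge 0\quad\Longleftrightarrow\quad \nu\ge\nu_R(k,1).$$ In addition, $\nu_R(k,1)<\nu_R(k+1,1)$ for any $k\in\mathbb{N}^+$, $\lim_{k\to+\infty}\nu_R(k,1)=+\infty$,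 and for every $k\in\mathbb{N}^+$ $$\frac{2\left(\sqrt2+1\right)^{\frac{1}{2k-1}}}{\left(\sqrt2+1\right)^{\frac{2}{2k-1}}-1}<\nu_R(k,1)<\frac{2\left(\sqrt2-1\right)^{\frac{1}{2k+1}}}{1-\left(\sqrt2-1\right)^{\frac{2}{2k+1}}}.$$
   Context: $L\in\mathbb{R}^{m\times m}$ with $m=2k+1$ is the circulant matrix with, indices modulo $m$, $L_{i,i+1}=\frac12$, $L_{i,i-1}=-\frac12$ ($1\le i\le m$), and all other entries $0$. $I$ is the $m\times m$ identity matrix. For a real matrix $M$, $M\ge 0$ means that every entry of $M$ is non-negative. $\mathbb{N}^+$ is the set of positive integers. *)

(* Defs.v *)
From HB Require Import structures.
From mathcomp Require Import all_boot all_order all_algebra.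
From mathcomp Require Import all_classical all_reals all_analysis.

Set Implicit Arguments.
Unset Strict Implicit.
Unset Printing Implicit Defensive.
Import Order.TTheory GRing.Theory Num.Theory.
Import numFieldNormedType.Exports.

Local Open Scope ring_scope.

(* Rows and columns are numbered from 0 instead of 1, which is harmless for a
   circulant matrix. [ordS] and [ord_pred] are the successor and predecessor
   modulo m. *)
Definition Lmx (R : realType) (m : nat) : 'M[R]_m :=
  \matrix_(i < m, j < m)
    (2^-1 *+ (j == ordS i) - 2^-1 *+ (j == ord_pred i)).

Definition Mmx (R : realType) (k : nat) (theta nu : R) : 'M[R]_((2 * k).+1) :=
  invmx (1%:M - (theta * nu) *: Lmx R (2 * k).+1) *m
  (1%:M + ((1 - theta) * nu) *: Lmx R (2 * k).+1).

Lemma Lmx_tr (R : realType) (m : nat) : (Lmx R m)^T = - Lmx R m.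
Proof.
apply/matrixP => i j; rewrite !mxE opprB.
rewrite -(can2_eq (@ordSK m) (@ord_predK m)).
by rewrite -(can2_eq (@ord_predK m) (@ordSK m)) ![_ == j]eq_sym.
Qed.

(* L is skew-symmetric, so [invmx] in [Mmx] is always a genuine inverse. *)
Lemma unitmx_Lmx (R : realType) (m : nat) (c : R) :
  1%:M - c *: Lmx R m \in unitmx.
Proof.
rewrite -row_free_unit -kermx_eq0; apply/rowV0P => x /sub_kermxP.
rewrite mulmxBr mulmx1 -scalemxAr => /subr0_eq xE.
have q0 : x *m Lmx R m *m x^T = 0.
  have : (x *m Lmx R m *m x^T)^T = - (x *m Lmx R m *m x^T).
    by rewrite !trmx_mul trmxK Lmx_tr mulNmx mulmxN mulmxA.
  move=> /matrixP/(_ 0 0); rewrite !mxE => /eqP.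
  rewrite -addr_eq0 -mulr2n mulrn_eq0 /= => /eqP q0.
  by apply/matrixP => i j; rewrite !ord1 [RHS]mxE -[RHS]q0 mxE.
have : x *m x^T = 0 by rewrite {1}xE -scalemxAl q0 scaler0.
move=> /matrixP/(_ 0 0); rewrite !mxE => /eqP.
rewrite psumr_eq0 => [/allP h|i _]; last by rewrite mxE -expr2 sqr_ge0.
apply/matrixP => i j; rewrite ord1 [RHS]mxE; apply/eqP.
by move: (h j (mem_index_enum j)); rewrite mxE -expr2 sqrf_eq0.
Qed.

(* Main.v *)
Require Import Defs.
From HB Require Import structures.
From mathcomp Require Import all_boot all_order all_algebra.
From mathcomp Require Import all_classical all_reals all_analysis.
From mathcomp Require Import zify ring lra.

(** Put a = theta nu and m = 2 k + 1. Since I + (1 - theta) nu L is a combination of I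
    and I - a L, for theta > 0 the matrix M is a positive multiple of
    (I - a L)^-1 - (1 - theta) I [Mmx_resolvent]. The inverse is the circulant Green
    function of a three-term recurrence with constant coefficients, whose characteristic
    roots are 1 / p and - p when a = 2 p / (1 - p^2). The map p |-> a is an increasing
    bijection from (0, 1) onto the positive reals [courant_le, courant_surj], so p
    replaces a, and the Green function is an explicit combination of powers of p
    [resolventE].

    In this closed form only odd circulant indices can produce negative entries, and
    index 1 is the worst. Therefore M >= 0 amounts to two scalar conditions [Mmx_ge0]:
    - off the diagonal, p^(2m-2) + p^m + p^(m-2) >= 1. The left side increases in p and
      decreases in k, so this is a lower bound on nu that grows with k;
    - on the diagonal, r_k(p^2) <= theta / (2 - theta), where
      r_k(u) = (u - u^m) / (1 - u^(m+1)). The recurrence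
      1 / r_(k+1) = u + 1 / u - r_k shows that r_k increases in u [diag_ratio_lt], so
      this is an upper bound on nu; moreover r_1 is the smallest of the r_k.

    Off the diagonal, k = 1 gives the weakest condition, p^2 + p >= 1, and this says
    r_1(p^2) >= 1/3, whereas theta / (2 - theta) < 1/3 for theta < 1/2 and = 1/3 for
    theta = 1/2. This settles theta <= 1/2, the extremal case being p^2 + p = 1. For
    theta < 1 the diagonal bound stays below 1, while for large k the off-diagonal
    condition forces p, and with it the ratio r_k(p^2), arbitrarily close to 1; so only
    finitely many k survive, and for each of them nu ranges over an interval cut out by
    the two monotone conditions. For theta = 1 the diagonal condition is vacuous, and the
    bounds on the threshold come from s^2 + 2 s = 1 for s = sqrt 2 - 1
    [courant_threshold_bounds]. *)

Set Implicit Arguments.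
Unset Strict Implicit.
Unset Printing Implicit Defensive.
Import Order.TTheory GRing.Theory Num.Theory.
Import numFieldNormedType.Exports.

Local Open Scope classical_set_scope.
Local Open Scope ring_scope.

(** * The decay rate as a substitute for theta nu *)

Lemma exprS_lt1 (R : realFieldType) (p : R) n : 0 < p < 1 -> p ^+ n.+1 < 1.
Proof. by case/andP=> p0 p1; rewrite exprn_ilt1 // ltW. Qed.

Lemma expr2_in01 (R : realFieldType) (p : R) : 0 < p < 1 -> 0 < p ^+ 2 < 1.
Proof.
move=> p01; rewrite (exprS_lt1 1) // andbT.
by case/andP: p01 => p0 _; rewrite exprn_gt0.
Qed.

(** The characteristic equation a x^2 - 2 x - a = 0 of the difference operator
    I - a L has the two real roots 1 / p and - p exactly when a = courant p. Since a
    runs once through the positive reals as p runs through (0, 1), p can replace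
    a = theta nu as the unknown. *)
Definition courant (R : realFieldType) (p : R) : R := 2 * p / (1 - p ^+ 2).

Lemma courant_gt0 (R : realFieldType) (p : R) : 0 < p < 1 -> 0 < courant p.
Proof.
move=> p01; have := exprS_lt1 1 p01; case/andP: p01 => p0 p1 p2.
by rewrite divr_gt0 ?subr_gt0 ?mulr_gt0.
Qed.

Lemma courant_le (R : realFieldType) (p q : R) : 0 < p < 1 -> 0 < q < 1 ->
  (courant p <= courant q) = (p <= q).
Proof.
move=> p01 q01; have := exprS_lt1 1 p01; have := exprS_lt1 1 q01.
case/andP: p01 => p0 p1; case/andP: q01 => q0 q1 q2 p2.
rewrite ler_pdivrMr ?subr_gt0 // mulrAC ler_pdivlMr ?subr_gt0 //.
rewrite -subr_ge0.
have -> : 2 * q * (1 - p ^+ 2) - 2 * p * (1 - q ^+ 2) =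
  2 * (1 + p * q) * (q - p) by ring.
by rewrite pmulr_rge0 ?subr_ge0 // mulr_gt0 // ltr_pwDr ?mulr_gt0.
Qed.

Lemma courant_lt (R : realFieldType) (p q : R) : 0 < p < 1 -> 0 < q < 1 ->
  (courant p < courant q) = (p < q).
Proof. by move=> p01 q01; rewrite !ltNge courant_le. Qed.

Lemma courant_surj (R : rcfType) (a : R) : 0 < a ->
  exists2 p, 0 < p < 1 & a = courant p.
Proof.
move=> a0; have s2 : Num.sqrt (1 + a ^+ 2) ^+ 2 = 1 + a ^+ 2.
  by rewrite sqr_sqrtr // addr_ge0 ?sqr_ge0.
have : 0 <= Num.sqrt (1 + a ^+ 2) by rewrite sqrtr_ge0.
move: (Num.sqrt _) s2 => s s2 s0.
have s1 : 1 < s by nra.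
have sa : s < 1 + a by nra.
(* The root of a p^2 + 2 p - a in (0, 1), with s = sqrt (1 + a^2). *)
exists ((s - 1) / a).
  by rewrite divr_gt0 ?subr_gt0 //= ltr_pdivrMr // mul1r ltrBlDl.
have aN0 : a != 0 by rewrite gt_eqF.
have -> : courant ((s - 1) / a) = 2 * (s - 1) * a / (a ^+ 2 - (s - 1) ^+ 2).
  rewrite /courant; field.
  rewrite aN0 /= gt_eqF //; nra.
have -> : a ^+ 2 - (s - 1) ^+ 2 = 2 * (s - 1) by nra.
by field; rewrite gt_eqF // subr_gt0.
Qed.

(** * The inverse of I - theta nu L *)

Lemma mul_Lmx (R : realType) (m n : nat) (A : 'M[R]_(m, n)) i j :
  (Lmx R m *m A) i j = 2^-1 * (A (ordS i) j - A (ord_pred i) j).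
Proof.
rewrite mxE; under eq_bigr do rewrite mxE mulrBl !mulrnAl !mulrb.
by rewrite sumrB -!big_mkcond !big_pred1_eq -mulrBr.
Qed.

(** The two characteristic solutions p^(-e) and (- p)^e are combined so that
    the sequence closes up after m = 2 k + 1 steps; the first one is scaled by p^m.
    The front factor normalizes the jump at e = 0 to 1. *)
Definition resolvent_coef (R : realFieldType) (k : nat) (p : R) (e : nat) : R :=
  (1 - p ^+ 2) / ((1 + p ^+ 2) * (1 - p ^+ (2 * k).+1 ^+ 2)) *
  ((1 + p ^+ (2 * k).+1) * p ^+ ((2 * k).+1 - e) +
   (1 - p ^+ (2 * k).+1) * (- p) ^+ e).

Definition resolvent (R : realFieldType) (k : nat) (p : R) : 'M[R]_((2 * k).+1) :=
  \matrix_(i, j) resolvent_coef k p ((i + ((2 * k).+1 - j)) %% (2 * k).+1).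

(** This equality at e = m is where m being odd enters: it gives
    (- p)^m = - p^m. *)
Lemma resolvent_coef_periodic (R : realFieldType) (k : nat) (p : R) e :
  (e <= (2 * k).+1)%N ->
  resolvent_coef k p (e %% (2 * k).+1) = resolvent_coef k p e.
Proof.
rewrite leq_eqVlt => /predU1P[->|em]; last by rewrite modn_small.
rewrite modnn /resolvent_coef subnn subn0 !expr0; congr (_ * _).
have -> : (- p) ^+ (2 * k).+1 = - p ^+ (2 * k).+1.
  by rewrite exprNn -signr_odd /= mul2n odd_double expr1 mulN1r.
ring.
Qed.

Lemma resolventE (R : realType) (k : nat) (p : R) : (0 < k)%N -> 0 < p < 1 ->
  (1%:M - courant p *: Lmx R (2 * k).+1) *m resolvent k p = 1%:M.
Proof.
move=> k0 p01; have /andP[p0 p1] := p01.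
apply/matrixP => i j.
rewrite mulmxBl mul1mx -scalemxAl mxE [X in _ + X]mxE [X in _ - X]mxE mul_Lmx.
rewrite !mxE /=.
set m := (2 * k).+1.
(* Both sides depend on the circulant index e = i - j modulo m only. *)
set e := ((i + (m - j)) %% m)%N.
have em : (e < m)%N by rewrite ltn_mod.
have jm : (j < m)%N := ltn_ord j.
have im : (i < m)%N := ltn_ord i.
have -> : ((i.+1 %% m + (m - j)) %% m = e.+1 %% m)%N.
  by rewrite modnDml addSn -addn1 -modnDml addn1.
have -> : (((i + m).-1 %% m + (m - j)) %% m = (e + m.-1) %% m)%N.
  by rewrite modnDml /e modnDml; congr (_ %% _)%N; lia.
have -> : (i == j) = (e == 0%N).
  apply/eqP/eqP => [ij|]; first by rewrite /e ij subnKC ?modnn // ltnW.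
  move=> e0; apply: ord_inj.
  have /dvdnP : (m %| i + (m - j))%N by rewrite /dvdn -/e e0.
  by case=> [[|[|q]]]; rewrite ?mul0n ?mul1n ?mulSn; lia.
have pm1 := exprS_lt1 (2 * k) p01; rewrite -/m in pm1.
have pm0 : 0 < p ^+ m by rewrite exprn_gt0.
have nz1 : 1 - p ^+ m ^+ 2 != 0 by rewrite gt_eqF//; nra.
have nz2 : 1 + p ^+ 2 != 0 by rewrite gt_eqF//; nra.
have nz3 : 1 - p ^+ 2 != 0 by rewrite gt_eqF//; nra.
(* The index e + 1 may wrap around to 0; periodicity hides this case. *)
rewrite [resolvent_coef k p (e.+1 %% m)]resolvent_coef_periodic //.
(* Row e = 0 carries the unit mass; there the predecessor index is m - 1. *)
case: (posnP e) => [->|e0] /=.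
  rewrite add0n modn_small // /resolvent_coef -/m /courant subn0 !expr1 expr0.
  have -> : (- p) ^+ (2 * k) = p ^+ (2 * k).
    by rewrite exprNn -signr_odd mul2n odd_double mul1r.
  have -> : (m - 2 * k = 1)%N by lia.
  have -> : (m - 1 = 2 * k)%N by lia.
  move: nz1; rewrite (exprS p (2 * k) : p ^+ m = _); set P := p ^+ (2 * k).
  move=> nz1; field.
  by rewrite nz1 nz2 nz3.
have -> : ((e + m.-1) %% m = e.-1)%N.
  have -> : (e + m.-1 = e.-1 + m)%N by lia.
  by rewrite modnDr modn_small //; lia.
rewrite /resolvent_coef -/m /courant.
(* With m - e = f + 1 the negative exponents disappear and the equation is linear
   in p ^+ f and in the preceding power of - p. *)
have [f mE] : exists f, m = (e + f.+1)%N by exists (m - e).-1; lia.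
have -> : (m - e = f.+1)%N by lia.
have -> : (m - e.+1 = f)%N by lia.
have -> : (m - e.-1 = f.+2)%N by lia.
case: (e) e0 => // d _ /=.
rewrite (exprS p f.+1) (exprS p f) (exprS (- p) d.+1) (exprS (- p) d).
move: (p ^+ m) nz1 => P nz1; field.
by rewrite nz1 nz2 nz3.
Qed.

(** Because I + (1 - theta) nu L is an affine combination of I and
    I - theta nu L, the discretization matrix is, up to scaling, the resolvent with its
    diagonal lowered by 1 - theta. *)
Lemma Mmx_resolvent (R : realType) k (theta nu p : R) :
  (0 < k)%N -> theta != 0 -> 0 < p < 1 -> theta * nu = courant p ->
  Mmx k theta nu = theta^-1 *: (resolvent k p - (1 - theta)%:M).
Proof.
move=> k0 t0 p01 tn; rewrite /Mmx.
have U := unitmx_Lmx (2 * k).+1 (theta * nu).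
apply: (canLR (mulKmx U)).
rewrite -scalemxAr mulmxBr tn resolventE // -tn mul_mx_scalar.
apply/matrixP => i j; rewrite !mxE.
by case: (i == j); rewrite /= ?mulr1n ?mulr0n; field.
Qed.

(** * Monotonicity of the two sign conditions *)

(** With m = 2 k + 1 the exponents are 2 m - 2, m and m - 2; the off-diagonal
    entries of the resolvent are nonnegative exactly when this is at least 1. *)
Definition offdiag_sum (R : realFieldType) (k : nat) (p : R) : R :=
  p ^+ (4 * k) + p ^+ (2 * k).+1 + p ^+ (2 * k).-1.

Lemma offdiag_sumE (R : realFieldType) k (p : R) : (0 < k)%N ->
  offdiag_sum k p = p ^+ (2 * k).+1 * p ^+ (2 * k).-1 +
    p ^+ (2 * k).+1 + p ^+ (2 * k).-1.
Proof.
move=> k0; rewrite -exprD /offdiag_sum; congr (_ ^+ _ + _ + _); lia.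
Qed.

Lemma offdiag_sum_lt (R : realFieldType) k (p q : R) : (0 < k)%N ->
  0 <= p -> p < q -> offdiag_sum k p < offdiag_sum k q.
Proof.
move=> k0 p0 pq.
by rewrite !ltrD // ltrXn2r //; lia.
Qed.

Lemma offdiag_sumS_lt (R : realFieldType) k (p : R) : (0 < k)%N ->
  0 < p < 1 -> offdiag_sum k.+1 p < offdiag_sum k p.
Proof.
move=> k0 /andP[p0 p1].
by rewrite !ltrD // ltr_iXn2l //; lia.
Qed.

Lemma offdiag_sum_le1 (R : realFieldType) k (p : R) : (0 < k)%N ->
  0 < p < 1 -> offdiag_sum k p <= offdiag_sum 1 p.
Proof.
move=> k0 /andP[p0 p1].
by rewrite !lerD // ler_wiXn2l ?(ltW p0) ?(ltW p1) //; lia.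
Qed.

Lemma offdiag_sum_le3 (R : realFieldType) k (p : R) : (0 < k)%N ->
  0 < p < 1 -> offdiag_sum k p <= 3 * p ^+ k.
Proof.
move=> k0 /andP[p0 p1].
have -> : 3 * p ^+ k = p ^+ k + p ^+ k + p ^+ k by ring.
by rewrite !lerD // ler_wiXn2l ?(ltW p0) ?(ltW p1) //; lia.
Qed.

(** The sum increases from 0 to 3 on the unit interval, so it takes the value 1. *)
Lemma offdiag_sum_root (R : rcfType) k : (0 < k)%N ->
  exists2 p : R, 0 < p < 1 & offdiag_sum k p = 1.
Proof.
move=> k0.
pose P : {poly R} := 'X^(4 * k) + 'X^((2 * k).+1) + 'X^((2 * k).-1) - 1%:P.
have PE x : P.[x] = offdiag_sum k x - 1 by rewrite /P !hornerE.
have S0 : offdiag_sum k (0 : R) = 0.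
  by rewrite /offdiag_sum !expr0n; do !(case: eqP; first by lia); rewrite !addr0.
have S1 : offdiag_sum k (1 : R) = 3 by rewrite /offdiag_sum !expr1n; ring.
have [|p /andP[p0 p1] rp] := @poly_ivt R P 0 1 ler01.
  by rewrite !PE S0 S1; apply/andP; split; lra.
have Sp : offdiag_sum k p = 1 by apply/eqP; rewrite -subr_eq0 -PE.
exists p => //; rewrite !lt_neqAle p0 p1 !andbT.
apply/andP; split; apply/eqP => pE; move: Sp.
  by rewrite -pE S0; lra.
by rewrite pE S1; lra.
Qed.

(** The off-diagonal condition is a lower bound on theta nu. *)
Lemma offdiag_sum_ge1 (R : realFieldType) k (p q : R) : (0 < k)%N ->
  0 < p < 1 -> 0 < q < 1 -> offdiag_sum k q = 1 ->
  (1 <= offdiag_sum k p) = (courant q <= courant p).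
Proof.
move=> k0 p01 q01 <-; rewrite courant_le //.
have /andP[p0 _] := p01; have /andP[q0 _] := q01.
case: (ltgtP q p) => [qp|pq|->].
- by rewrite ltW // offdiag_sum_lt // ltW.
- by rewrite leNgt offdiag_sum_lt // ltW.
- by rewrite lexx.
Qed.

(** With u = p^2 and m = 2 k + 1 this is (u - u^m) / (1 - u^(m + 1)), the image
    of the diagonal entry c of the resolvent under the involution
    c |-> (1 - c) / (1 + c). In this variable the dependence on k becomes a simple
    recurrence. *)
Definition diag_ratio (R : realFieldType) (k : nat) (u : R) : R :=
  u * (1 - u ^+ (2 * k)) / (1 - u ^+ (2 * k).+2).

Lemma diag_ratio_ge0 (R : realFieldType) k (u : R) : 0 < u < 1 ->
  0 <= diag_ratio k u.
Proof.
move=> u01; have /andP[u0 u1] := u01.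
by rewrite divr_ge0 ?mulr_ge0 ?subr_ge0 ?exprn_ile1 // ltW.
Qed.

Lemma diag_ratio_lt1 (R : realFieldType) k (u : R) : 0 < u < 1 ->
  diag_ratio k u < 1.
Proof.
move=> u01; have /andP[u0 u1] := u01.
have := exprS_lt1 (2 * k).+1 u01.
rewrite /diag_ratio exprS [u ^+ (2 * k).+1]exprS.
have : 0 < u ^+ (2 * k) by rewrite exprn_gt0.
have : u ^+ (2 * k) <= 1 by rewrite exprn_ile1 // ltW.
move: (_ ^+ _) => x x1 x0 y1.
rewrite ltr_pdivrMr ?subr_gt0 // mul1r -subr_gt0.
have -> : 1 - u * (u * x) - u * (1 - x) = (1 - u) * (1 + u * x) by ring.
by rewrite mulr_gt0 ?subr_gt0 // ltr_pwDr ?mulr_gt0.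
Qed.

(** The ratio is u T_k / T_(k+1), where T_k = 1 + u^2 + .. + u^(2k-2), and
    T_(k+2) = (1 + u^2) T_(k+1) - u^2 T_k. *)
Lemma diag_ratio_rec (R : realFieldType) k (u : R) : 0 < u < 1 ->
  diag_ratio k.+1 u = (u + u^-1 - diag_ratio k u)^-1.
Proof.
move=> u01; have /andP[u0 u1] := u01.
have := exprS_lt1 (2 * k).+3 u01; have := exprS_lt1 (2 * k).+1 u01.
rewrite /diag_ratio.
have -> : (2 * k.+1 = (2 * k).+2)%N by lia.
rewrite !(exprS u); move: (u ^+ (2 * k)) => x x1 x2; field.
by rewrite !gt_eqF //; nra.
Qed.

(** By induction along the recurrence: u + 1 / u decreases on (0, 1), so the
    denominator u + 1 / u - diag_ratio k u decreases and its inverse increases. This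
    replaces a differentiation of the diagonal entry. *)
Lemma diag_ratio_lt (R : realFieldType) k (u v : R) : (0 < k)%N ->
  0 < u -> u < v -> v < 1 -> diag_ratio k u < diag_ratio k v.
Proof.
move=> + u0 uv v1.
have u01 : 0 < u < 1 by rewrite u0 (lt_trans uv).
have v01 : 0 < v < 1 by rewrite v1 (lt_trans u0).
have uvV : v + v^-1 < u + u^-1.
  rewrite -subr_gt0.
  have -> : u + u^-1 - (v + v^-1) = (v - u) * (1 - u * v) / (u * v).
    by field; rewrite !gt_eqF //; lra.
  by rewrite divr_gt0 // ?mulr_gt0 ?subr_gt0 //; nra.
have vV : 1 < v^-1 by rewrite invf_gt1 //; lra.
elim: k => // k IH _.
(* At k = 0 both ratios vanish, so only a weak inequality is available. *)
have le_k : diag_ratio k u <= diag_ratio k v.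
  case: k IH => [_|k IH]; last by rewrite ltW ?IH.
  by rewrite /diag_ratio muln0 !expr0 subrr !mulr0 !mul0r.
have := diag_ratio_lt1 k v01.
rewrite !diag_ratio_rec //.
move: (diag_ratio k u) (diag_ratio k v) le_k => x y xy y1.
by rewrite ltf_pV2 ?posrE; lra.
Qed.

Lemma diag_ratio_le (R : realFieldType) k (u v : R) : (0 < k)%N ->
  0 < u < 1 -> 0 < v < 1 -> (diag_ratio k u <= diag_ratio k v) = (u <= v).
Proof.
move=> k0 /andP[u0 u1] /andP[v0 v1]; case: (ltgtP u v) => [uv|vu|->].
- by rewrite ltW // diag_ratio_lt.
- by rewrite leNgt diag_ratio_lt.
- by rewrite lexx.
Qed.

Lemma diag_ratio1 (R : realFieldType) (u : R) : 0 < u < 1 ->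
  diag_ratio 1 u = u / (1 + u ^+ 2).
Proof.
move=> u01; have := exprS_lt1 3 u01; have := exprS_lt1 1 u01.
case/andP: u01 => u0 u1; rewrite /diag_ratio muln1.
have -> : u ^+ 4 = u ^+ 2 ^+ 2 by rewrite -exprM.
have : 0 < u ^+ 2 by rewrite exprn_gt0.
move: (u ^+ 2) => w w0 w1 w2; field; rewrite !gt_eqF//; nra.
Qed.

Lemma diag_ratio1_lt (R : realFieldType) k (u : R) : (1 < k)%N -> 0 < u < 1 ->
  diag_ratio 1 u < diag_ratio k u.
Proof.
case: k => [|[|k]] // _ u01; have /andP[u0 u1] := u01.
rewrite diag_ratio1 // /diag_ratio.
have -> : (2 * k.+2 = (2 * k).+1.+3)%N by lia.
have x1 := exprS_lt1 (2 * k).+1 u01.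
have y1 := exprS_lt1 (2 * k).+1.+4 u01.
have z0 : 0 < u ^+ 2 by rewrite exprn_gt0.
have x0 : 0 < u ^+ (2 * k).+2 by rewrite exprn_gt0.
move: y1.
have -> : u ^+ (2 * k).+1.+4.+1 = u ^+ (2 * k).+2 * u ^+ 2 * u ^+ 2.
  by rewrite -!exprD; congr (_ ^+ _); lia.
have -> : u ^+ (2 * k).+1.+3 = u ^+ (2 * k).+2 * u ^+ 2.
  by rewrite -!exprD; congr (_ ^+ _); lia.
move: (u ^+ (2 * k).+2) (u ^+ 2) x0 x1 z0 => x z x0 x1 z0 y1.
have z3 : 0 < 1 + z by rewrite addr_gt0.
have y3 : 0 < 1 - x * z * z by rewrite subr_gt0.
rewrite -subr_gt0.
have -> : u * (1 - x * z) / (1 - x * z * z) - u / (1 + z) =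
    u * z * (1 - x) / ((1 - x * z * z) * (1 + z)).
  by field; rewrite !gt_eqF.
by rewrite divr_gt0 ?mulr_gt0 ?subr_gt0.
Qed.

Lemma diag_ratio1_lek (R : realFieldType) k (u : R) : (0 < k)%N -> 0 < u < 1 ->
  diag_ratio 1 u <= diag_ratio k u.
Proof.
case: k => [|[|k]] // _ u01.
by rewrite ltW // diag_ratio1_lt.
Qed.

(** The intermediate value theorem for polynomials provides the largest
    admissible p. *)
Lemma diag_ratio_threshold (R : rcfType) k (tau p0 p1 : R) : (0 < k)%N ->
  0 < p0 < 1 -> 0 < p1 < 1 ->
  diag_ratio k (p0 ^+ 2) <= tau -> tau <= diag_ratio k (p1 ^+ 2) ->
  exists2 q, 0 < q < 1 & diag_ratio k (q ^+ 2) = tau.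
Proof.
move=> k0 p001 p101 r0 r1.
have /andP[p00 p0l] := p001; have /andP[p10 p1l] := p101.
have den (p : R) : 0 < p < 1 -> 0 < 1 - p ^+ 2 ^+ (2 * k).+2.
  by move=> p01; rewrite subr_gt0; exact: exprS_lt1 (expr2_in01 p01).
have p0p1 : p0 <= p1.
  have := le_trans r0 r1.
  rewrite diag_ratio_le ?expr2_in01 //.
  by rewrite ler_pXn2r ?nnegrE ?(ltW p00) ?(ltW p10).
(* The equation for the ratio, cleared of its positive denominator. *)
pose P : {poly R} := 'X^2 * (1 - 'X^2 ^+ (2 * k)) -
  tau *: (1 - 'X^2 ^+ ((2 * k).+2)).
have PE (p : R) : 0 < p < 1 ->
    P.[p] = (diag_ratio k (p ^+ 2) - tau) * (1 - p ^+ 2 ^+ (2 * k).+2).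
  move=> p01; rewrite mulrBl divfK ?gt_eqF ?den //.
  by rewrite /P !hornerE.
have [|q /andP[q0 q1] /eqP qP] := @poly_ivt R P p0 p1 p0p1.
  rewrite !PE // pmulr_lle0 ?den // pmulr_lge0 ?den //.
  by rewrite subr_le0 subr_ge0 r0.
have q01 : 0 < q < 1 by rewrite (lt_le_trans p00) // (le_lt_trans q1).
exists q => //; move: qP; rewrite PE // => /eqP.
by rewrite mulf_eq0 [X in _ || X]gt_eqF ?den // orbF subr_eq0 => /eqP.
Qed.

(** * Nonnegativity in terms of the decay rate *)

Lemma resolvent_coef0 (R : realFieldType) k (p : R) : 0 < p < 1 ->
  resolvent_coef k p 0 =
  (1 - diag_ratio k (p ^+ 2)) / (1 + diag_ratio k (p ^+ 2)).
Proof.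
move=> /expr2_in01 u01.
have PE : p ^+ (2 * k).+1 ^+ 2 = p ^+ 2 * p ^+ 2 ^+ (2 * k).
  by rewrite -exprS exprAC.
have -> : resolvent_coef k p 0 = (1 - p ^+ 2) / ((1 + p ^+ 2) *
   (1 - p ^+ (2 * k).+1 ^+ 2)) * (1 + p ^+ (2 * k).+1 ^+ 2).
  by rewrite /resolvent_coef subn0 expr0; ring.
have /andP[u0 u1] := u01.
have := exprS_lt1 (2 * k).+1 u01; have := exprS_lt1 (2 * k) u01.
rewrite PE /diag_ratio !(exprS (p ^+ 2)).
have : 0 < p ^+ 2 ^+ (2 * k) by rewrite exprn_gt0.
move: (p ^+ 2 ^+ (2 * k)) => x x0.
move: (p ^+ 2) u0 u1 => u u0 u1 y1 z1; clear -x0 u0 u1 y1 z1.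
field.
by rewrite !gt_eqF //; nra.
Qed.

Lemma resolvent_coef_factor_gt0 (R : realFieldType) k (p : R) : 0 < p < 1 ->
  0 < (1 - p ^+ 2) / ((1 + p ^+ 2) * (1 - p ^+ (2 * k).+1 ^+ 2)).
Proof.
move=> p01; have /andP[p0 p1] := p01.
have := exprS_lt1 1 p01; have := exprS_lt1 (2 * k) p01.
have : 0 < p ^+ (2 * k).+1 by rewrite exprn_gt0.
move: (p ^+ _.+1) => P P0 P1 p21.
by rewrite divr_gt0 ?mulr_gt0; nra.
Qed.

Lemma resolvent_coef_ge0_even (R : realFieldType) k (p : R) e : 0 < p < 1 ->
  ~~ odd e -> 0 <= resolvent_coef k p e.
Proof.
move=> p01 oe; have /andP[p0 p1] := p01.
have P1 := ltW (exprS_lt1 (2 * k) p01).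
rewrite mulr_ge0 ?(ltW (resolvent_coef_factor_gt0 k p01)) //.
rewrite exprNn -signr_odd (negPf oe) expr0 mul1r.
have pn0 n : 0 <= p ^+ n by rewrite exprn_ge0 // ltW.
by rewrite addr_ge0 // mulr_ge0 // ?subr_ge0 // addr_ge0.
Qed.

(** After division by p the entry next to the diagonal is a positive multiple
    of P Q + P + Q - 1, where P = p^m and Q = p^(m - 2). *)
Lemma resolvent_coef1_ge0 (R : realFieldType) k (p : R) :
  (0 < k)%N -> 0 < p < 1 ->
  (0 <= resolvent_coef k p 1) = (1 <= offdiag_sum k p).
Proof.
move=> k0 p01; have /andP[p0 p1] := p01.
rewrite pmulr_rge0 ?resolvent_coef_factor_gt0 // offdiag_sumE //.
have -> : ((2 * k).+1 - 1 = (2 * k).-1.+1)%N by lia.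
rewrite [p ^+ _.-1.+1]exprS expr1.
move: (p ^+ (2 * k).+1) (p ^+ (2 * k).-1) => P Q.
have -> : (1 + P) * (p * Q) + (1 - P) * - p = p * (P * Q + P + Q - 1) by ring.
by rewrite pmulr_rge0 // subr_ge0.
Qed.

(** At odd e the solution (- p)^e is negative and decays with e while the other
    one grows, so the entry e = 1 is the worst. *)
Lemma resolvent_coef_ge0_odd (R : realFieldType) k (p : R) e : 0 < p < 1 ->
  (e <= 2 * k)%N -> odd e ->
  0 <= resolvent_coef k p 1 -> 0 <= resolvent_coef k p e.
Proof.
move=> p01 ek oe; have /andP[p0 p1] := p01.
have e0 : (0 < e)%N by case: (e) oe.
have P1 := exprS_lt1 (2 * k) p01.
have P0 : 0 < p ^+ (2 * k).+1 by rewrite exprn_gt0.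
rewrite !pmulr_rge0 ?resolvent_coef_factor_gt0 //.
rewrite [(- p) ^+ e]exprNn -signr_odd oe expr1 mulN1r.
have : p ^+ e <= p by rewrite -[leRHS]expr1 ler_wiXn2l ?(ltW p0) ?(ltW p1).
have : p ^+ ((2 * k).+1 - 1) <= p ^+ ((2 * k).+1 - e).
  by apply: ler_wiXn2l; [exact: ltW|exact: ltW|lia].
move: P0 P1; move: (p ^+ (2 * k).+1) => P.
move: (p ^+ e) (p ^+ (_ - 1)) (p ^+ (_ - e)) => A B C.
nra.
Qed.

(** Nonnegativity of all entries reduces to the entry next to the diagonal and
    the diagonal one: entries at even circulant index are nonnegative,
    and index 1 controls all odd ones. *)
Lemma Mmx_ge0 (R : realType) k (theta nu p : R) :
  (0 < k)%N -> 0 < theta < 2 -> 0 < p < 1 -> theta * nu = courant p ->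
  Mmx k theta nu \is a mxOver Num.nneg <->
  1 <= offdiag_sum k p /\ diag_ratio k (p ^+ 2) <= theta / (2 - theta).
Proof.
move=> k0 /andP[t0 t2] p01 tn.
have tN0 : theta != 0 by rewrite gt_eqF.
have entryE i j : Mmx k theta nu i j = theta^-1 *
    (resolvent_coef k p ((i + ((2 * k).+1 - j)) %% (2 * k).+1) -
     (1 - theta) *+ (i == j)).
  by rewrite (Mmx_resolvent k0 tN0 p01 tn) !mxE.
have diagE : (0 <= resolvent_coef k p 0 - (1 - theta)) =
    (diag_ratio k (p ^+ 2) <= theta / (2 - theta)).
  have u01 := expr2_in01 p01.
  have := diag_ratio_ge0 k u01; have := diag_ratio_lt1 k u01.
  rewrite resolvent_coef0 //; move: (diag_ratio _ _) => r r1 r0.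
  rewrite subr_ge0 ler_pdivlMr ?ler_pdivlMr ?subr_gt0 //; last by lra.
  by apply/idP/idP; lra.
split=> [/mxOverP M0|[S1 r1]].
  split.
    rewrite -resolvent_coef1_ge0 //.
    have h1 : (1 < (2 * k).+1)%N by lia.
    have := M0 (Ordinal h1) ord0.
    rewrite entryE nnegrE pmulr_rge0 ?invr_gt0 // subr0 /= subn0.
    by rewrite modnDr modn_small.
  have := M0 ord0 ord0.
  by rewrite entryE nnegrE pmulr_rge0 ?invr_gt0 // eqxx mulr1n /= modnn diagE.
apply/mxOverP => i j.
rewrite entryE nnegrE pmulr_rge0 ?invr_gt0 //.
case: eqP => [->|ij].
  by rewrite mulr1n subnKC ?modnn ?diagE // ltnW.
rewrite mulr0n subr0.
set e := (_ %% _)%N.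
have ek : (e <= 2 * k)%N by rewrite -ltnS ltn_mod.
case oe : (odd e); last by rewrite resolvent_coef_ge0_even // oe.
by rewrite resolvent_coef_ge0_odd // resolvent_coef1_ge0.
Qed.

Lemma Mmx_theta_gt0 (R : realType) k (theta nu : R) :
  (0 < k)%N -> 0 < theta < 2 -> 0 < nu ->
  exists p, [/\ 0 < p < 1, theta * nu = courant p &
  Mmx k theta nu \is a mxOver Num.nneg <->
  1 <= offdiag_sum k p /\ diag_ratio k (p ^+ 2) <= theta / (2 - theta)].
Proof.
move=> k0 t02 nu0; have /andP[t0 _] := t02.
have [p p01 tn] := courant_surj (mulr_gt0 t0 nu0).
by exists p; split => //; apply: Mmx_ge0.
Qed.

(** * The range theta <= 1/2 *)

Lemma offdiag_sum1_ge1 (R : realFieldType) (p : R) :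
  (1 <= offdiag_sum 1 p) = (1 <= p ^+ 2 + p).
Proof.
rewrite -subr_ge0 -[RHS]subr_ge0.
(* p^4 + p^3 + p - 1 factors through the golden ratio polynomial. *)
have -> : offdiag_sum 1 p - 1 = (p ^+ 2 + 1) * (p ^+ 2 + p - 1).
  by rewrite /offdiag_sum /=; ring.
by rewrite pmulr_rge0 // ltr_wpDl ?sqr_ge0.
Qed.

(** 1 + p^4 - 3 p^2 = (1 - p^2)^2 - p^2 is a difference of squares; one factor is
    positive and the other is 1 - p - p^2. *)
Lemma diag_ratio1_le_third (R : realFieldType) (p : R) : 0 < p < 1 ->
  (diag_ratio 1 (p ^+ 2) <= 1 / 3) = (p ^+ 2 + p <= 1).
Proof.
move=> p01; have /andP[p0 p1] := p01.
rewrite diag_ratio1 ?expr2_in01 // ler_pdivrMr; last first.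
  by rewrite ltr_wpDr ?sqr_ge0.
rewrite -subr_ge0 -[RHS]subr_ge0.
have -> : 1 / 3 * (1 + p ^+ 2 ^+ 2) - p ^+ 2 =
  (1 + p - p ^+ 2) / 3 * (1 - (p ^+ 2 + p)) by field.
rewrite pmulr_rge0 // divr_gt0 //.
have := exprS_lt1 1 p01; lra.
Qed.

Lemma Mmx_has_neg (R : realType) k (theta nu : R) :
  ~ (Mmx k theta nu \is a mxOver Num.nneg) ->
  exists i j : 'I_(2 * k).+1, Mmx k theta nu i j < 0.
Proof.
move=> nM; apply: contrapT => nex; apply: nM; apply/mxOverP => i j.
by rewrite nnegrE leNgt; apply/negP => ltM; apply: nex; exists i, j.
Qed.

(** For theta = 0 the matrix is I + nu L, whose subdiagonal is - nu / 2. *)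
Lemma Mmx0_has_neg (R : realType) k (nu : R) : (0 < k)%N -> 0 < nu ->
  exists i j : 'I_(2 * k).+1, Mmx k 0 nu i j < 0.
Proof.
move=> k0 nu0.
have h1 : (1 < (2 * k).+1)%N by lia.
exists (Ordinal h1), ord0.
rewrite /Mmx mul0r scale0r !subr0 invmx1 mul1mx !mxE.
have -> : (ord0 == ordS (Ordinal h1)) = false.
  by rewrite -val_eqE /= modn_small //; lia.
have -> : (ord0 == ord_pred (Ordinal h1)) = true.
  by rewrite -val_eqE /= add0n modnn.
rewrite /= mulr0n mulr1n; lra.
Qed.

(** Nonnegativity off the diagonal forces p^2 + p >= 1, hence a ratio of at least
    1 / 3 for k = 1 and for every larger k; the diagonal needs a ratio of at most
    theta / (2 - theta), which is below 1 / 3 for theta < 1 / 2. *)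
Lemma Mmx_theta_lt_half (R : realType) (theta : R) : 0 <= theta < 1 / 2 ->
  forall (k : nat) (nu : R), (0 < k)%N -> 0 < nu ->
  exists i j : 'I_(2 * k).+1, Mmx k theta nu i j < 0.
Proof.
move=> /andP[]; rewrite le_eqVlt => /predU1P[<- _|t0 t1] k nu k0 nu0.
  exact: Mmx0_has_neg.
have t02 : 0 < theta < 2 by rewrite t0 /=; lra.
have [p [p01 _ Mp]] := Mmx_theta_gt0 k0 t02 nu0.
apply: Mmx_has_neg => /Mp[S1 r1].
have tau : theta / (2 - theta) < 1 / 3 by rewrite ltr_pdivrMr; lra.
have : diag_ratio 1 (p ^+ 2) < 1 / 3.
  apply: le_lt_trans tau; apply: le_trans r1.
  by rewrite diag_ratio1_lek ?expr2_in01.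
(* The two conditions squeeze p onto p^2 + p = 1, where the ratio is exactly 1 / 3. *)
move: (le_trans S1 (offdiag_sum_le1 k0 p01)).
rewrite offdiag_sum1_ge1 => pp r3.
have := ltW r3; rewrite diag_ratio1_le_third // => pp'.
move: r3; rewrite diag_ratio1 ?expr2_in01 //.
have {}pp : p ^+ 2 = 1 - p by lra.
rewrite ltr_pdivrMr ?ltr_wpDr ?sqr_ge0 // pp; nra.
Qed.

(** At theta = 1 / 2 the diagonal bound is exactly 1 / 3. Equality must hold
    everywhere, which forces k = 1 and p^2 + p = 1, and then nu = 4 p / (1 - p^2) = 4. *)
Lemma Mmx_theta_half (R : realType) k (nu : R) : (0 < k)%N -> 0 < nu ->
  Mmx k (1 / 2) nu \is a mxOver Num.nneg <-> k = 1%N /\ nu = 4.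
Proof.
move=> k0 nu0.
have t02 : 0 < (1 / 2 : R) < 2 by apply/andP; split; lra.
have [p [p01 tn Mp]] := Mmx_theta_gt0 k0 t02 nu0.
have tau : 1 / 2 / (2 - 1 / 2) = 1 / 3 :> R by field.
rewrite tau in Mp.
have p21 := exprS_lt1 1 p01.
have p2N0 : 1 - p ^+ 2 != 0 by rewrite gt_eqF ?subr_gt0.
have nuE : nu * (1 - p ^+ 2) = 4 * p.
  have -> : nu = 2 * courant p by lra.
  by rewrite /courant; field.
split=> [/Mp[S1 r1]|[kE nu4]].
  have pp := le_trans S1 (offdiag_sum_le1 k0 p01).
  rewrite offdiag_sum1_ge1 in pp.
  have r3 := le_trans (diag_ratio1_lek k0 (expr2_in01 p01)) r1.
  have pp' : p ^+ 2 + p <= 1 by rewrite -diag_ratio1_le_third.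
  have ppE : 1 - p ^+ 2 = p by lra.
  split; last first.
    have pN0 : p != 0 by rewrite -ppE.
    by apply: (mulIf pN0); rewrite -[in LHS]ppE.
  apply/eqP; move: k0; rewrite eq_sym leq_eqVlt => /orP[//|k1].
  have := diag_ratio1_lt k1 (expr2_in01 p01).
  have : 1 / 3 <= diag_ratio 1 (p ^+ 2).
    rewrite diag_ratio1 ?expr2_in01 // ler_pdivlMr ?ltr_wpDr ?sqr_ge0 //.
    have -> : p ^+ 2 = 1 - p by lra.
    nra.
  lra.
have ppE : p ^+ 2 + p = 1 by rewrite nu4 in nuE; lra.
apply/Mp; rewrite kE offdiag_sum1_ge1 diag_ratio1_le_third // ppE.
by rewrite lexx.
Qed.

(** * The range 1/2 < theta < 1 *)

Lemma expr_small (R : realType) (p e : R) : 0 < p < 1 -> 0 < e ->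
  \forall k \near \oo, p ^+ k < e.
Proof.
move=> /andP[p0 p1] e0; apply: cvgr_lt e0.
by apply: cvg_expr; rewrite gtr0_norm.
Qed.

Lemma offdiag_sum_small (R : realType) (p : R) : 0 < p < 1 ->
  \forall k \near \oo, offdiag_sum k p < 1.
Proof.
move=> p01; near=> k.
have k0 : (0 < k)%N by near: k; exact: nbhs_infty_gt.
apply: le_lt_trans (offdiag_sum_le3 k0 p01) _.
rewrite mulrC -ltr_pdivlMr //.
by near: k; apply: expr_small => //; rewrite divr_gt0.
Unshelve. all: by end_near. Qed.

(** For theta < 1 the admissible ratios stay below tau < 1. As k grows the
    off-diagonal condition forces p towards 1, and the ratio towards 1 with it. *)
Lemma Mmx_theta_lt1_finite (R : realType) (theta : R) : 0 < theta < 1 ->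
  finite_set [set k : nat | (0 < k)%N /\
    exists nu : R, 0 < nu /\ Mmx k theta nu \is a mxOver Num.nneg].
Proof.
move=> /andP[t0 t1].
have t02 : 0 < theta < 2 by rewrite t0 /=; lra.
pose tau := theta / (2 - theta).
have tau0 : 0 < tau by rewrite divr_gt0 //; lra.
have tau1 : tau < 1 by rewrite ltr_pdivrMr; lra.
(* For a fixed q < 1 the ratio at q tends to q^2 as k grows, so q^2 > tau makes it
   exceed tau, while the off-diagonal sum at q tends to 0. *)
have [q q01 qtau] : exists2 q : R, 0 < q < 1 & tau < q ^+ 2.
  exists ((1 + tau) / 2); first by apply/andP; split; lra.
  rewrite expr2; nra.
have q201 := expr2_in01 q01; have /andP[q20 q21] := q201.
have [K _ KP] : \forall k \near \oo, offdiag_sum k q < 1 /\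
    (0 < k)%N /\ tau < diag_ratio k (q ^+ 2).
  near=> k.
  have k0 : (0 < k)%N by near: k; exact: nbhs_infty_gt.
  split; first by near: k; exact: offdiag_sum_small.
  split=> //.
  have qk : q ^+ 2 ^+ k < 1 - tau / q ^+ 2.
    near: k; apply: expr_small => //.
    by rewrite subr_gt0 ltr_pdivrMr // mul1r.
  have : q ^+ 2 ^+ (2 * k) <= q ^+ 2 ^+ k.
    by rewrite ler_wiXn2l ?(ltW q20) ?(ltW q21) //; lia.
  rewrite /diag_ratio; have := exprS_lt1 (2 * k).+1 q201.
  have : 0 < q ^+ 2 ^+ (2 * k).+2 by rewrite exprn_gt0.
  move: (_ ^+ (2 * k).+2) (_ ^+ (2 * k)) => y x y0 y1 xk.
  have xtau : tau < q ^+ 2 * (1 - x).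
    rewrite mulrC -ltr_pdivrMr //; lra.
  apply: (lt_le_trans xtau); rewrite ler_pdivlMr ?subr_gt0 //.
  by rewrite ler_piMr //; lra.
apply: (sub_finite_set _ (finite_II K)) => k [k0 [nu [nu0 /=]]].
have [p [p01 _ Mp]] := Mmx_theta_gt0 k0 t02 nu0.
move=> /Mp[S1 r1]; rewrite ltnNge; apply/negP => /KP /= [Sq [_ rq]].
(* The off-diagonal condition pushes p above q, hence the ratio above tau. *)
have qp : q < p.
  rewrite ltNge; apply/negP; rewrite le_eqVlt => /predU1P[pq|pq].
    by move: S1; rewrite pq leNgt Sq.
  have /andP[p0 _] := p01.
  have := offdiag_sum_lt k0 (ltW p0) pq; lra.
have /andP[q0 q1] := q01; have /andP[p0 p1] := p01.
have : diag_ratio k (q ^+ 2) <= diag_ratio k (p ^+ 2).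
  by rewrite diag_ratio_le ?expr2_in01 // lerXn2r ?nnegrE ?ltW.
rewrite -/tau in r1; lra.
Unshelve. all: by end_near. Qed.

(** Off the diagonal theta nu is bounded below by a threshold, and on the diagonal
    it is bounded above because the ratio increases with p; the upper bound is infinite
    when the ratio never reaches theta / (2 - theta) on (0, 1). *)
Lemma Mmx_theta_interval (R : realType) (theta : R) k :
  0 < theta < 2 -> (0 < k)%N ->
  (exists nu : R, 0 < nu /\ Mmx k theta nu \is a mxOver Num.nneg) ->
  exists (nuR : R) (nuL : \bar R),
    [/\ 0 < nuR, (nuR%:E <= nuL)%E &
        [set nu : R | 0 < nu /\ Mmx k theta nu \is a mxOver Num.nneg] =
        [set nu : R | nuR <= nu /\ (nu%:E <= nuL)%E]].
Proof.
move=> t02 k0 [nu0 [nu0_gt0 M0]]; have /andP[t0 _] := t02.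
pose tau := theta / (2 - theta).
have [q q01 Sq] := offdiag_sum_root R k0.
have nuR0 : 0 < courant q / theta by rewrite divr_gt0 ?courant_gt0.
have [nuL nuLP] : exists nuL : \bar R, forall p nu, 0 < p < 1 ->
    theta * nu = courant p ->
    diag_ratio k (p ^+ 2) <= tau <-> (nu%:E <= nuL)%E.
  have [all_le|] :=
    pselect (forall p, 0 < p < 1 -> diag_ratio k (p ^+ 2) <= tau).
    by exists +oo%E => p nu p01 _; rewrite leey; split=> // _; exact: all_le.
  move=> /existsNP[p1 /not_implyP[p101 /negP]]; rewrite -ltNge => r1.
  have [p0 [p001 _ Mp0]] := Mmx_theta_gt0 k0 t02 nu0_gt0.
  have [_ r0] := Mp0.1 M0.
  have [l l01 rl] := diag_ratio_threshold k0 p001 p101 r0 (ltW r1).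
  exists (courant l / theta)%:E => p nu p01 tn.
  rewrite lee_fin [nu <= _]ler_pdivlMr // mulrC tn courant_le // /tau -rl.
  have /andP[p0' _] := p01; have /andP[l0 _] := l01.
  rewrite diag_ratio_le ?expr2_in01 //.
  by rewrite ler_pXn2r ?nnegrE ?(ltW p0') ?(ltW l0).
have memE nu : 0 < nu /\ Mmx k theta nu \is a mxOver Num.nneg <->
    courant q / theta <= nu /\ (nu%:E <= nuL)%E.
  have key : 0 < nu -> Mmx k theta nu \is a mxOver Num.nneg <->
      courant q / theta <= nu /\ (nu%:E <= nuL)%E.
    move=> nu_gt0; have [p [p01 tn Mp]] := Mmx_theta_gt0 k0 t02 nu_gt0.
    rewrite ler_pdivrMr // mulrC tn -(offdiag_sum_ge1 k0 p01 q01 Sq).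
    by apply: (iff_trans Mp); rewrite (nuLP p nu p01 tn).
  split=> [[nu_gt0 /(key nu_gt0)//]|h].
  have nu_gt0 : 0 < nu by exact: lt_le_trans h.1.
  by split=> //; apply/(key nu_gt0).
exists (courant q / theta), nuL; split => //.
  have [h1 h2] := (memE nu0).1 (conj nu0_gt0 M0).
  by apply: le_trans h2; rewrite lee_fin.
by apply/seteqP; split=> nu /memE.
Qed.

(** * The implicit Euler method theta = 1 *)

Lemma powR_root (R : realType) (a : R) n : 0 < a -> (0 < n)%N ->
  (a `^ (1 / n%:R)) ^+ n = a.
Proof.
move=> a0 n0; rewrite -powR_mulrn ?powR_ge0 // -powRrM mulrVK ?powRr1 ?ltW //.
by rewrite unitfE pnatr_eq0 -lt0n.
Qed.

Lemma powR_root_sqr (R : realType) (a x : R) :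
  a `^ (2 / x) = (a `^ (1 / x)) ^+ 2.
Proof.
by rewrite -powR_mulrn ?powR_ge0 // -powRrM; congr (_ `^ _); ring.
Qed.

(** The number s = sqrt 2 - 1 solves s^2 + 2 s = 1. With P = p^m and Q = p^(m - 2)
    the threshold equation is P Q + P + Q = 1, and P < Q, so P < s < Q. Hence the
    threshold lies strictly between the p with Q = s and the p with P = s. *)
Lemma courant_threshold_bounds (R : realType) k (p : R) : (0 < k)%N ->
  0 < p < 1 -> offdiag_sum k p = 1 ->
  2 * (Num.sqrt 2 + 1) `^ (1 / (2 * k%:R - 1)) /
    ((Num.sqrt 2 + 1) `^ (2 / (2 * k%:R - 1)) - 1) < courant p /\
  courant p < 2 * (Num.sqrt 2 - 1) `^ (1 / (2 * k%:R + 1)) /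
    (1 - (Num.sqrt 2 - 1) `^ (2 / (2 * k%:R + 1))).
Proof.
move=> k0 p01 Sp; rewrite !powR_root_sqr.
have -> : 2 * k%:R - 1 = (2 * k).-1%:R :> R.
  by rewrite -subn1 natrB ?natrM //; lia.
have -> : 2 * k%:R + 1 = (2 * k).+1%:R :> R by rewrite -[in RHS]natr1 natrM.
have s2 : Num.sqrt 2 ^+ 2 = 2 :> R by rewrite sqr_sqrtr.
have s0 : 0 <= Num.sqrt 2 :> R by rewrite sqrtr_ge0.
move: (Num.sqrt _) s2 s0 => s s2 s0.
have s1 : 1 < s by nra.
have sl2 : s < 2 by nra.
have n0 : (0 < (2 * k).-1)%N by lia.
split.
  (* sqrt 2 + 1 and sqrt 2 - 1 are inverse, so the lower bound is
     courant (1 / t), where 1 / t has the power sqrt 2 - 1 at exponent 2 k - 1. *)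
  have t0 : 0 < s + 1 by lra.
  have := powR_root t0 n0; have := powR_gt0 (1 / (2 * k).-1%:R) t0.
  move: (_ `^ _) => t t_gt0 tn.
  have tVn : t^-1 ^+ (2 * k).-1 = s - 1.
    rewrite exprVn tn; apply: (mulfI (lt0r_neq0 t0)).
    rewrite mulfV ?gt_eqF //; nra.
  have tV0 : 0 < t^-1 by rewrite invr_gt0.
  have tV1 : t^-1 < 1 by rewrite -(expr_lt1 n0 (ltW tV0)) tVn; lra.
  have tV01 : 0 < t^-1 < 1 by rewrite tV0.
  have tV2 := exprS_lt1 1 tV01.
  have -> : 2 * t / (t ^+ 2 - 1) = courant t^-1.
    have t1 : 1 < t by rewrite invf_lt1 in tV1.
    rewrite /courant; field; rewrite gt_eqF //=; rewrite ?gt_eqF //; nra.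
  rewrite ltNge -(offdiag_sum_ge1 k0 tV01 p01 Sp) -ltNge offdiag_sumE //.
  have : t^-1 ^+ (2 * k).+1 < s - 1.
    by rewrite -tVn ltr_iXn2l //; lia.
  rewrite tVn; move: (_ ^+ _) => x xs; nra.
(* The upper bound is courant t, where t ^+ (2 * k).+1 = sqrt 2 - 1. *)
have t0 : 0 < s - 1 by lra.
have := powR_root t0 (ltn0Sn (2 * k)).
have := powR_gt0 (1 / (2 * k).+1%:R) t0.
move: (_ `^ _) => t t_gt0 tn.
have t1 : t < 1.
  rewrite -(expr_lt1 (ltn0Sn (2 * k)) (ltW t_gt0)) tn; lra.
have t01 : 0 < t < 1 by rewrite t_gt0.
rewrite -/(courant t) courant_lt // ltNge; apply/negP => tp.
have /andP[p0 _] := p01.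
have : offdiag_sum k t <= 1.
  rewrite -Sp; move: tp; rewrite le_eqVlt => /predU1P[->//|tp].
  by rewrite ltW // offdiag_sum_lt // ltW.
rewrite offdiag_sumE // tn.
have : s - 1 < t ^+ (2 * k).-1.
  by rewrite -tn ltr_iXn2l //; lia.
move: (_ ^+ _) => x xs; nra.
Qed.

(** For theta = 1 the diagonal condition reads ratio <= 1 and always holds, so the
    off-diagonal threshold is the only constraint. It increases with k because the
    off-diagonal sum decreases with k, and it is unbounded because that sum tends to 0
    at each fixed p. *)
Lemma Mmx_theta1_threshold (R : realType) :
  exists nuR : nat -> R,
     [/\ forall k : nat, (0 < k)%N -> 0 < nuR k /\
           forall nu : R, 0 < nu ->
             (Mmx k 1 nu \is a mxOver Num.nneg <-> nuR k <= nu),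
         forall k : nat, (0 < k)%N -> nuR k < nuR k.+1,
         nuR k @[k --> \oo] --> +oo &
         forall k : nat, (0 < k)%N ->
           2 * (Num.sqrt 2 + 1) `^ (1 / (2 * k%:R - 1)) /
             ((Num.sqrt 2 + 1) `^ (2 / (2 * k%:R - 1)) - 1) < nuR k /\
           nuR k < 2 * (Num.sqrt 2 - 1) `^ (1 / (2 * k%:R + 1)) /
             (1 - (Num.sqrt 2 - 1) `^ (2 / (2 * k%:R + 1)))].
Proof.
have [q qP] : {q : nat -> R & forall k, (0 < k)%N ->
    0 < q k < 1 /\ offdiag_sum k (q k) = 1}.
  apply: (@choice _ _ (fun k p => (0 < k)%N ->
    0 < p < 1 /\ offdiag_sum k p = 1)) => -[|k]; first by exists 0.
  by have [p p01 Sp] := offdiag_sum_root R (ltn0Sn k); exists p.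
exists (fun k => courant (q k)); split=> [k k0|k k0||k k0].
- have [q01 Sq] := qP k k0; split; first exact: courant_gt0.
  move=> nu nu0; have t02 : 0 < (1 : R) < 2 by apply/andP; split; lra.
  have [p [p01 tn Mp]] := Mmx_theta_gt0 k0 t02 nu0.
  apply: (iff_trans Mp); rewrite -[nu]mul1r tn.
  rewrite -(offdiag_sum_ge1 k0 p01 q01 Sq).
  split=> [[]//|S1]; split=> //.
  have -> : 1 / (2 - 1) = 1 :> R by field.
  by rewrite ltW // diag_ratio_lt1 // expr2_in01.
- have [q01 Sq] := qP k k0; have [q01' Sq'] := qP k.+1 (ltn0Sn k).
  rewrite ltNge -(offdiag_sum_ge1 _ q01 q01' Sq') // -ltNge -Sq.
  exact: offdiag_sumS_lt.
- apply/cvgryPge => A.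
  have A0 : 0 < Num.max A 1 by rewrite lt_max ltr01 orbT.
  have [p p01 AE] := courant_surj A0.
  near=> k.
  have k0 : (0 < k)%N by near: k; exact: nbhs_infty_gt.
  have [q01 Sq] := qP k k0.
  apply: (@le_trans _ _ (courant p)); first by rewrite -AE le_max lexx.
  rewrite leNgt; apply/negP => /ltW; rewrite -(offdiag_sum_ge1 _ p01 q01 Sq) //.
  apply/negP; rewrite -ltNge; near: k; exact: offdiag_sum_small.
- have [q01 Sq] := qP k k0; exact: courant_threshold_bounds.
Unshelve. all: by end_near. Qed.

Theorem theorem2 (R : realType) :
  (* (a) *)
  (forall theta : R, 0 <= theta < 1 / 2 ->
     forall (k : nat) (nu : R), (0 < k)%N -> 0 < nu ->
       exists i j : 'I_(2 * k).+1, Mmx k theta nu i j < 0) /\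
  (* (b) *)
  (forall (k : nat) (nu : R), (0 < k)%N -> 0 < nu ->
     Mmx k (1 / 2) nu \is a mxOver Num.nneg <-> k = 1%N /\ nu = 4) /\
  (* (c) *)
  (forall theta : R, 1 / 2 < theta < 1 ->
     finite_set [set k : nat | (0 < k)%N /\
       exists nu : R, 0 < nu /\ Mmx k theta nu \is a mxOver Num.nneg] /\
     forall k : nat, (0 < k)%N ->
       (exists nu : R, 0 < nu /\ Mmx k theta nu \is a mxOver Num.nneg) ->
       exists (nuR : R) (nuL : \bar R),
         [/\ 0 < nuR, (nuR%:E <= nuL)%E &
             [set nu : R | 0 < nu /\ Mmx k theta nu \is a mxOver Num.nneg] =
             [set nu : R | nuR <= nu /\ (nu%:E <= nuL)%E]]) /\
  (* (d) *)
  (exists nuR : nat -> R,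
     [/\ forall k : nat, (0 < k)%N -> 0 < nuR k /\
           forall nu : R, 0 < nu ->
             (Mmx k 1 nu \is a mxOver Num.nneg <-> nuR k <= nu),
         forall k : nat, (0 < k)%N -> nuR k < nuR k.+1,
         nuR k @[k --> \oo] --> +oo &
         forall k : nat, (0 < k)%N ->
           2 * (Num.sqrt 2 + 1) `^ (1 / (2 * k%:R - 1)) /
             ((Num.sqrt 2 + 1) `^ (2 / (2 * k%:R - 1)) - 1) < nuR k /\
           nuR k < 2 * (Num.sqrt 2 - 1) `^ (1 / (2 * k%:R + 1)) /
             (1 - (Num.sqrt 2 - 1) `^ (2 / (2 * k%:R + 1)))]).
Proof.
split; first exact: Mmx_theta_lt_half.
split; first exact: Mmx_theta_half.
split; last exact: Mmx_theta1_threshold.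
move=> theta /andP[t_half t1].
have t0 : 0 < theta by lra.
split; first by apply: Mmx_theta_lt1_finite; rewrite t0.
by move=> k; apply: Mmx_theta_interval; rewrite t0 /=; lra.
Qed.
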